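(* Let $\{S(t): t\ge 0\}$ be a semigroup on a nonempty subset $V$ of a Hilbert space $(X,\|\cdot\|_X)$ over $\mathbb{K}\in\{\mathbb{R},\mathbb{C}\}$, let $B$ be a subset of $V$, and let $T>0$, $\eta\in[0,1)$, $\kappa>0$. Suppose that the semigroup satisfies the smoothing property on $B$ at time $T$ with parameters $(\eta,\kappa)$ in the following form: $S(T)=C(T)+M(T)$, where $$\|C(T)x-C(T)y\|_X\le\eta\|x-y\|_X,\quad x,y\in B,$$ and $M(T):B\to Z$, where $Z$ is an auxiliary normed space compactly embedded into $X$, with $$\|M(T)x-M(T)y\|_Z\le\kappa\|x-y\|_X,\quad x,y\in B.$$ Then the semigroup is of Ladyzhenskaya type on $B$ at time $T$ (that is, with some parameters $(n,\eta',\kappa')$).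
   Context: A semigroup $\{S(t):t\ge0\}$ on $V$ is a family of (not necessarily linear) maps $S(t):V\to V$ with $S(t)S(s)=S(t+s)$ for $t,s\ge 0$ and $S(0)=I$, the identity map on $V$; ''$t\ge 0$'' means throughout either $t\in[0,\infty)$ or $t\in\mathbb{N}_0=\mathbb{N}\cup\{0\}$. A semigroup on a nonempty subset $V$ of a normed space $(X,\|\cdot\|_X)$ is of Ladyzhenskaya type on a subset $B$ of $V$ at time $T>0$ with parameters $(n,\eta',\kappa')$ if there exist a subspace $X_n$ of $X$ of dimension $n\in\mathbb{N}$, a map $P:V\to X_n$ and constants $\eta'\in[0,1)$, $\kappa'>0$ such that for all $x,y\in B$ $$\|(I-P)S(T)x-(I-P)S(T)y\|_X\le\eta'\|x-y\|_X,\qquad\|PS(T)x-PS(T)y\|_X\le\kappa'\|x-y\|_X.$$ *)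

(* Defs.v *)
From HB Require Import structures.
From mathcomp Require Import all_boot all_order all_algebra.
From mathcomp Require Import sesquilinear complex.
From mathcomp Require Import all_classical all_reals all_analysis.

Set Implicit Arguments.
Unset Strict Implicit.
Unset Printing Implicit Defensive.

Import Order.TTheory GRing.Theory Num.Theory.
Import numFieldNormedType.Exports.

Local Open Scope classical_set_scope.
Local Open Scope ring_scope.

Variant scalar_kind := RealScalars | ComplexScalars.

(* MathComp norms on a K-vector space take values in K.  For K = R[i] the order
   is partial: 0 <= a and 0 < a force a to be a real number, and a <= b forces
   b - a to be one, so inequalities between norms have their usual meaning. *)
Definition scalars (R : realType) (k : scalar_kind) : numFieldType :=
  match k with
  | RealScalars => R
  | ComplexScalars => R[i]
  end.

Definition scalar_conj (R : realType) (k : scalar_kind) :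
    scalars R k -> scalars R k :=
  match k return scalars R k -> scalars R k with
  | RealScalars => idfun
  | ComplexScalars => @conjc R
  end.

(* The norm comes from an inner product, linear in its first argument;
   completeness is carried by the type of X. *)
Definition is_hilbert (R : realType) (k : scalar_kind)
    (X : completeNormedModType (scalars R k)) : Prop :=
  exists dot : {dot X for @scalar_conj R k}, forall x : X, `|x| ^+ 2 = dot x x.

Definition continuous_time (R : realType) : set R := [set t | 0 <= t].
Definition discrete_time (R : realType) : set R := range (fun n : nat => n%:R).

(* Maps defined on a subset are total functions on the ambient space, whose
   values outside of that subset are irrelevant. *)
Definition semigroup (R : realType) (X : Type) (time : set R) (V : set X)
    (S : R -> X -> X) : Prop :=
  [/\ forall t, time t -> set_fun V V (S t),
      forall t s x, time t -> time s -> V x -> S t (S s x) = S (t + s) x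
    & forall x, V x -> S 0 x = x].

(* The embedding of Z into X is an injective, continuous linear map that sends
   bounded sets to relatively compact ones. *)
Definition compact_embedding (K : numFieldType) (Z X : normedModType K)
    (i : {linear Z -> X}) : Prop :=
  [/\ injective i, continuous i
    & forall A : set Z, bounded_set A -> precompact (i @` A)].

Definition linearly_independent (K : numFieldType) (X : lmodType K) (n : nat)
    (e : 'I_n -> X) : Prop :=
  forall a : 'I_n -> K, \sum_(j < n) a j *: e j = 0 -> forall j, a j = 0.

Definition subspace_of_dim (K : numFieldType) (X : lmodType K) (n : nat)
    (W : set X) : Prop :=
  exists2 e : 'I_n -> X, linearly_independent e
    & W = range (fun a : 'I_n -> K => \sum_(j < n) a j *: e j).

(* The dimension n is a positive integer; n = 0 is admitted only if X = {0},
   which has no subspace of positive dimension.  P is an arbitrary map. *)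
Definition ladyzhenskaya_type (K : numFieldType) (R : realType)
    (X : normedModType K) (V : set X) (S : R -> X -> X) (B : set X) (T : R)
    (n : nat) (eta kappa : K) : Prop :=
  [/\ (exists x : X, x != 0) -> (0 < n)%N, 0 <= eta < 1, 0 < kappa
    & exists (Xn : set X) (P : X -> X),
      [/\ subspace_of_dim n Xn,
          set_fun V Xn P,
          forall x y, B x -> B y ->
            `|(S T x - P (S T x)) - (S T y - P (S T y))| <= eta * `|x - y|
        & forall x y, B x -> B y ->
            `|P (S T x) - P (S T y)| <= kappa * `|x - y|]].

(* Main.v *)
(* A compact embedding maps the unit ball of Z to a set with a finite
   delta-net in X.  If P is the orthogonal projection onto the span of the net,
   then I - P kills the net and does not increase norms, so
   |(I - P) i z| <= delta |z|.  Hence (I - P) S(T) is Lipschitz on B with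
   constant eta + delta kappa, which is below 1 for small delta, and P S(T) is
   Lipschitz because P, C(T) and i M(T) are. *)
Require Import Defs.
From HB Require Import structures.
From mathcomp Require Import all_boot all_order all_algebra.
From mathcomp Require Import sesquilinear finmap.
From mathcomp Require Import all_classical all_reals all_analysis.

Set Implicit Arguments.
Unset Strict Implicit.
Unset Printing Implicit Defensive.

Import Order.TTheory GRing.Theory Num.Theory.
Import numFieldNormedType.Exports.

Local Open Scope classical_set_scope.
Local Open Scope ring_scope.

Section OrthogonalProjection.
Variables (K : numFieldType) (X : normedModType K) (theta : K -> K).
Variables (dot : {dot X for theta}).
Hypothesis dot_norm : forall x, `|x| ^+ 2 = dot x x.

Definition orthonormal_family (n : nat) (e : 'I_n -> X) :=
  forall j l, dot (e j) (e l) = (j == l)%:R.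

Definition oproj (n : nat) (e : 'I_n -> X) (x : X) : X :=
  \sum_(j < n) dot x (e j) *: e j.

(** Since [theta] is an arbitrary map here, [theta 0 = 0] is read off from hermitian symmetry at the
    pair of zero vectors. *)
Lemma dot_orthC x y : dot x y = 0 -> dot y x = 0.
Proof.
have dotC u v : dot u v = theta (dot v u).
  by rewrite [LHS]hermitian_subproof mul1r.
have theta0 : theta 0 = 0.
  by have := dotC 0 0; rewrite linear0l => <-.
by move=> xy0; rewrite dotC xy0 theta0.
Qed.

Lemma dot_suml (I : finType) (F : I -> X) y :
  dot (\sum_j F j) y = \sum_j dot (F j) y.
Proof. by elim/big_rec2: _ => [|j u v _ <-]; rewrite ?linear0l ?linearDl. Qed.

Lemma norm_pythagoras x y : dot x y = 0 -> `|x + y| ^+ 2 = `|x| ^+ 2 + `|y| ^+ 2.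
Proof.
move=> xy0; rewrite !dot_norm linearDl !linearDr/=.
by rewrite [dot x y]xy0 [dot y x](dot_orthC xy0) addr0 add0r.
Qed.

Lemma oproj_is_linear n (e : 'I_n -> X) : linear (oproj e).
Proof.
move=> a x y; rewrite /oproj scaler_sumr -big_split; apply: eq_bigr => j _ /=.
by rewrite linearDl linearZl_LR/= scalerDl scalerA.
Qed.

HB.instance Definition _ n (e : 'I_n -> X) :=
  GRing.isLinear.Build K X X *:%R (oproj e) (oproj_is_linear e).

Section Family.
Variables (n : nat) (e : 'I_n -> X).
Hypothesis e_on : orthonormal_family e.

Lemma dot_orthonormal_sum (a : 'I_n -> K) l :
  dot (\sum_(j < n) a j *: e j) (e l) = a l.
Proof.
rewrite dot_suml (bigD1 l)//= big1 => [|j jl]; rewrite linearZl_LR/= e_on.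
  by rewrite eqxx mulr1 addr0.
by rewrite (negbTE jl) mulr0.
Qed.

Lemma orthonormal_linearly_independent : linearly_independent e.
Proof. by move=> a a0 j; rewrite -(dot_orthonormal_sum a) a0 linear0l. Qed.

Lemma oproj_id_orth x l : dot (x - oproj e x) (e l) = 0.
Proof. by rewrite linearBl/= dot_orthonormal_sum subrr. Qed.

Lemma oproj_orth x y : dot (oproj e y) (x - oproj e x) = 0.
Proof.
rewrite dot_suml big1// => j _.
by rewrite linearZl_LR/= (dot_orthC (oproj_id_orth x j)) mulr0.
Qed.

Lemma norm_oproj_split x : `|x| ^+ 2 = `|oproj e x| ^+ 2 + `|x - oproj e x| ^+ 2.
Proof. by rewrite -norm_pythagoras ?oproj_orth// addrC subrK. Qed.

Lemma norm_oproj_le x : `|oproj e x| <= `|x|.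
Proof.
by rewrite -(ler_pXn2r (ltn0Sn 1))// ?nnegrE// (norm_oproj_split x) lerDl exprn_ge0.
Qed.

Lemma norm_sub_oproj_le x : `|x - oproj e x| <= `|x|.
Proof.
by rewrite -(ler_pXn2r (ltn0Sn 1))// ?nnegrE// (norm_oproj_split x) lerDr exprn_ge0.
Qed.

End Family.

(** Induction on [s], which may be linearly dependent: a vector already fixed by the projection adds
    nothing, any other contributes its normalized residual. Membership in the span is expressed as
    being fixed by [oproj]. *)
Lemma gram_schmidt (s : seq X) : exists (n : nat) (e : 'I_n -> X),
  orthonormal_family e /\ {in s, forall v, oproj e v = v}.
Proof.
elim: s => [|v s [n [e [e_on es]]]].
  by exists 0%N, (fun=> 0); split=> // -[].
have [v_span|v_span] := eqVneq (v - oproj e v) 0.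
  exists n, e; split=> // w; rewrite inE => /predU1P[->|/es//].
  by apply/esym/subr0_eq.
set r := v - oproj e v in v_span *.
have r_orth l : dot r (e l) = 0 by exact: oproj_id_orth.
have r_gt0 : 0 < `|r| by rewrite normr_gt0.
pose u := `|r|^-1 *: r.
have u_orth l : dot u (e l) = 0 by rewrite linearZl_LR/= r_orth mulr0.
have uu : dot u u = 1.
  by rewrite -dot_norm normrZ gtr0_norm ?invr_gt0// mulVf ?expr1n ?gt_eqF.
(* The new vector [u] takes index 0 and the old family is shifted by one. *)
pose e' (j : 'I_n.+1) := oapp e u (unlift ord0 j).
have e'0 : e' ord0 = u by rewrite /e' unlift_none.
have e'S j : e' (lift ord0 j) = e j by rewrite /e' liftK.
have e'_proj x : oproj e' x = dot x u *: u + oproj e x.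
  rewrite /oproj big_ord_recl e'0; congr (_ + _).
  by apply: eq_bigr => j _; rewrite e'S.
exists n.+1, e'; split=> [j l|w].
  case: (unliftP ord0 j) => [j'|] ->; case: (unliftP ord0 l) => [l'|] ->;
    rewrite ?e'0 ?e'S ?uu ?u_orth ?eqxx//.
  by rewrite (dot_orthC (u_orth j')).
have rE : r = `|r| *: u by rewrite scalerA mulfV ?scale1r ?gt_eqF.
have span_u y : dot (oproj e y) u = 0.
  rewrite dot_suml big1// => j _.
  by rewrite linearZl_LR/= (dot_orthC (u_orth j)) mulr0.
rewrite inE e'_proj => /predU1P[->|/[dup] ws /es ew].
  (* As [oproj e v] is orthogonal to [u], the coefficient of [v] along [u] is [|r|], so the new term
     is exactly the missing residual [r]. *)
  have vE : v = r + oproj e v by rewrite subrK.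
  rewrite {1}vE linearDl/= [dot (oproj e v) u]span_u addr0.
  by rewrite {1}rE linearZl_LR/= uu mulr1 -rE -vE.
(* Earlier vectors lie in the old span, hence are orthogonal to [u]. *)
by rewrite -{1}ew [dot _ u]span_u scale0r add0r.
Qed.

End OrthogonalProjection.

(** The balls of radius [delta] around all points of [X] cover the compact closure of [A]; the
    centres of a finite subcover form the net and need not lie in [A]. *)
Lemma precompact_net (K : numFieldType) (X : normedModType K) (A : set X)
    (delta : K) : precompact A -> 0 < delta ->
  exists s : seq X, forall x, A x -> exists2 c, c \in s & `|x - c| < delta.
Proof.
move=> pA d0; move: pA; rewrite precompactE compact_cover.
move=> /(_ X setT (fun c => ball c delta)).
case=> [c _|x _|s _ s_cover]; first exact: ball_open.
  by exists x => //; exact: ballxx.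
exists s => x Ax; have [c cs] := s_cover _ (subset_closure Ax).
by rewrite -ball_normE/= distrC => xc; exists c.
Qed.

Lemma compact_embedding_net (K : numFieldType) (Z X : normedModType K)
    (i : {linear Z -> X}) (delta : K) : compact_embedding i -> 0 < delta ->
  exists s : seq X, forall z, `|z| = 1 ->
    exists2 c, c \in s & `|i z - c| < delta.
Proof.
move=> [_ _ i_compact] d0.
have /i_compact/precompact_net/(_ d0)[s hs] :
    bounded_set [set z : Z | `|z| = 1].
  by exists 1; split=> [|y /ltW y1 z /= ->]; rewrite ?real1.
by exists s => z z1; apply: hs; exists z.
Qed.

Theorem proposition7p4 (R : realType) (k : scalar_kind)
    (X : completeNormedModType (scalars R k)) (HX : is_hilbert X)
    (time : set R)
    (Htime : time = @continuous_time R \/ time = @discrete_time R)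
    (V : set X) (V0 : V !=set0)
    (S : R -> X -> X) (HS : semigroup time V S)
    (B : set X) (BV : B `<=` V)
    (T : R) (timeT : time T) (T0 : 0 < T)
    (eta kappa : scalars R k) (Heta : 0 <= eta < 1) (Hkappa : 0 < kappa)
    (Z : normedModType (scalars R k)) (i : {linear Z -> X})
    (Hi : compact_embedding i)
    (C : X -> X) (M : X -> Z)
    (HST : forall x, B x -> S T x = C x + i (M x))
    (HC : forall x y, B x -> B y -> `|C x - C y| <= eta * `|x - y|)
    (HM : forall x y, B x -> B y -> `|M x - M y| <= kappa * `|x - y|) :
  exists (n : nat) (eta' kappa' : scalars R k),
    ladyzhenskaya_type V S B T n eta' kappa'.
Proof.
have [dot dot_norm] := HX.
have /andP[eta_ge0 eta_lt1] := Heta.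
(* This choice makes [eta + delta * kappa] the midpoint of [eta] and 1. *)
have [delta delta_gt0 deltak] :
    exists2 delta, 0 < delta & delta * kappa = (1 - eta) / 2.
  exists ((1 - eta) / 2 / kappa); first by rewrite !divr_gt0 ?subr_gt0.
  by rewrite divfK ?gt_eqF.
have [s s_net] := compact_embedding_net Hi delta_gt0.
(* Adding a nonzero vector to the net forces [n] to be positive; the default 0 serves only the
   trivial space. *)
have [x0 x0_neq0] : exists x0 : X, (exists x : X, x != 0) -> x0 != 0.
  have [[x0 ?]|] := pselect (exists x : X, x != 0); first by exists x0.
  by exists 0.
have [n [e [e_on e_span]]] := gram_schmidt dot_norm (x0 :: s).
pose P : {linear X -> X} := oproj dot e.
have QD x y : x + y - P (x + y) = (x - P x) + (y - P y).
  by rewrite linearD opprD addrACA.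
have QB x y : x - y - P (x - y) = (x - P x) - (y - P y).
  by rewrite linearB !opprD addrACA.
(* By homogeneity [z] may be normalized. With [c] in the net close to the image [w], [P c = c] gives
   [(I - P) w = (I - P) (w - c)], of norm at most [|w - c|]. *)
have i_small z : `|i z - P (i z)| <= delta * `|z|.
  have [->|z0] := eqVneq z 0.
    by rewrite !linear0 addr0 !normr0 mulr0.
  have z_gt0 : 0 < `|z| by rewrite normr_gt0.
  have [|c cs cz] := s_net (`|z|^-1 *: z).
    by rewrite normrZ gtr0_norm ?invr_gt0// mulVf ?gt_eqF.
  have Pc : P c = c by apply: e_span; rewrite inE cs orbT.
  rewrite -ler_pdivrMr// mulrC -[_^-1]gtr0_norm ?invr_gt0// -normrZ.
  rewrite scalerBr -!linearZ/=.
  set w := i _ in cz *.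
  suff -> : w - P w = w - c - P (w - c).
    by apply: le_trans (norm_sub_oproj_le dot_norm e_on _) _; exact: ltW.
  by rewrite QB Pc subrr subr0.
have [L L_gt0 i_bnd] : exists2 L, 0 < L & forall z, `|i z| <= L * `|z|.
  have [_ i_cont _] := Hi.
  by apply/pinfty_ex_gt0/linear_boundedP/linear_bounded_continuous.
have ST_B x y : B x -> B y ->
    S T x - S T y = (C x - C y) + i (M x - M y).
  by move=> Bx By; rewrite !HST// linearB opprD addrACA.
exists n, (eta + delta * kappa), (eta + L * kappa); split.
(* If [n] were 0, the projection would be the zero map, yet it fixes [x0]. *)
- move=> /x0_neq0; case: n e e_on e_span @P QD QB i_small => // e _ e_span.
  by rewrite -(e_span x0) ?mem_head// /oproj big_ord0 eqxx.
- apply/andP; split; first by rewrite addr_ge0// ltW// mulr_gt0.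
  rewrite deltak -ltrBrDl ltr_pdivrMr//.
  by rewrite ltr_pMr ?subr_gt0// ltr1n.
- by rewrite ltr_wpDl// mulr_gt0.
exists (range (fun a : 'I_n -> scalars R k => \sum_(j < n) a j *: e j)), P.
split.
- by exists e => //; exact: (orthonormal_linearly_independent e_on).
- by move=> x _; exists (fun j => dot x (e j)).
- move=> x y Bx By; rewrite -QB ST_B// QD.
  apply: le_trans (ler_normD _ _) _; rewrite mulrDl lerD//.
    by rewrite (le_trans (norm_sub_oproj_le dot_norm e_on _))// HC.
  by rewrite (le_trans (i_small _))// -mulrA ler_pM2l// HM.
(* [P] does not increase norms, so a Lipschitz constant of [S T] on [B] suffices. *)
- move=> x y Bx By; rewrite -linearB.
  apply: le_trans (norm_oproj_le dot_norm e_on _) _.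
  rewrite ST_B// (le_trans (ler_normD _ _))// mulrDl lerD ?HC//.
  by rewrite (le_trans (i_bnd _))// -mulrA ler_pM2l// HM.
Qed.
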